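(* Let $A\subset\mathbb{R}^m$ be a nonempty compact set. Let $f:[0,T]\times\mathbb{R}^n\times A\to\mathbb{R}^n$ and $l:[0,T]\times\mathbb{R}^n\times A\to\mathbb{R}$ be measurable in $t$ for all $(x,a)\in\mathbb{R}^n\times A$ and continuous in $(x,a)$ for all $t\in[0,T]$. Assume that for every $R>0$ there exist a modulus $w_R$ and a null set $\mathcal{N}_R\subset[0,T]$ such that $|l(t,x,a)-l(t,y,a)|\le w_R(t,|x-y|)$ for all $t\in[0,T]\setminus\mathcal{N}_R$, $x,y\in B_R$, $a\in A$. Let $$H(t,x,p):=\sup_{a\in A}\{\langle p,f(t,x,a)\rangle-l(t,x,a)\},\qquad L(t,x,v):=\sup_{p\in\mathbb{R}^n}\{\langle v,p\rangle-H(t,x,p)\}.$$ Then there exists $\lambda:[0,T]\times\mathbb{R}^n\to\mathbb{R}$, measurable in $t$ for all $x\in\mathbb{R}^n$ and continuous in $x$ for all $t\in[0,T]$, such that $L(t,x,v)\le\lambda(t,x)$ for all $t\in[0,T]$, $x\in\mathbb{R}^n$, $v\in\mathrm{dom}\,L(t,x,\cdot)$, and such that for every $R>0$, with the same modulus $w_R$ and for some null set $\tilde{\mathcal{N}}_R\subset[0,T]$, one has $|\lambda(t,x)-\lambda(t,y)|\le w_R(t,|x-y|)$ for all $t\in[0,T]\setminus\tilde{\mathcal{N}}_R$ and $x,y\in B_R$. Moreover, if $f$ and $l$ are continuous (jointly in $(t,x,a)$), then $\lambda$ is also continuous (jointly in $(t,x)$).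
   Context: $|\cdot|$ is the Euclidean norm, $\langle\cdot,\cdot\rangle$ the scalar product, and $B_R$ is the closed ball in $\mathbb{R}^n$ centered at $0$ with radius $R$. Measurable means Lebesgue measurable and a null set is a set of Lebesgue measure zero. A modulus is a function $w:[0,T]\times[0,\infty)\to[0,\infty)$ such that $w(\cdot,r)$ is measurable for every $r\ge0$ and, for every $t\in[0,T]$, $w(t,\cdot)$ is nondecreasing, continuous, subadditive and $w(t,0)=0$. $\mathrm{dom}\,\varphi:=\{x:\varphi(x)\ne\pm\infty\}$. *)

(* Defs.v *)
From HB Require Import structures.
From mathcomp Require Import all_boot all_order all_algebra.
From mathcomp Require Import all_classical all_reals all_analysis.

Set Implicit Arguments.
Unset Strict Implicit.
Unset Printing Implicit Defensive.

Import Order.TTheory GRing.Theory Num.Theory.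
Import numFieldNormedType.Exports.

Local Open Scope classical_set_scope.
Local Open Scope ring_scope.

(* The library's norm on matrices is the sup norm; it has the same topology as
   the Euclidean norm, but distances and balls have to be Euclidean. *)
Definition dot (R : realType) (n : nat) (u v : 'rV[R]_n) : R :=
  \sum_(i < n) u 0 i * v 0 i.

Definition enorm (R : realType) (n : nat) (u : 'rV[R]_n) : R :=
  Num.sqrt (dot u u).

Definition eball (R : realType) (n : nat) (r : R) : set 'rV[R]_n :=
  [set x | enorm x <= r].

(* R with the sigma-algebra of Lebesgue measurable sets; the library's default
   instance on R, measurableTypeR, is the Borel sigma-algebra. *)
Definition lebesgueType (R : realType) :=
  caratheodory_type ((wlength (idfun : R -> R))^*)%mu.

Definition lebesgue_measurable_fun (R : realType) (I : set R) (g : R -> R) :=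
  measurable_fun (I : set (lebesgueType R))
    (g : lebesgueType R -> measurableTypeR R).

(* The codomain carries its Borel sigma-algebra. *)
Definition lebesgue_measurable_vfun (R : realType) (n : nat) (I : set R)
    (g : R -> 'rV[R]_n) :=
  measurable_fun (I : set (lebesgueType R))
    (g : lebesgueType R -> g_sigma_algebraType (@open 'rV[R]_n)).

(* A function on [0, T] x [0, +oo[ is a total function whose values elsewhere
   are unconstrained. *)
Definition modulus (R : realType) (T : R) (w : R -> R -> R) : Prop :=
  [/\ forall t r, t \in `[0, T] -> 0 <= r -> 0 <= w t r,
      forall r, 0 <= r -> lebesgue_measurable_fun `[0, T] (w ^~ r)
    & forall t, t \in `[0, T] ->
      [/\ forall r s, 0 <= r -> r <= s -> w t r <= w t s,
          {within `[0, +oo[, continuous (w t)},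
          forall r s, 0 <= r -> 0 <= s -> w t (r + s) <= w t r + w t s
        & w t 0 = 0]].

Definition null_subset (R : realType) (T : R) (N : set R) : Prop :=
  N `<=` `[0, T] /\ (@lebesgue_measure R).-negligible N.

Definition Hamiltonian (R : realType) (n m : nat) (A : set 'rV[R]_m)
    (f : R -> 'rV[R]_n -> 'rV[R]_m -> 'rV[R]_n)
    (l : R -> 'rV[R]_n -> 'rV[R]_m -> R)
    (t : R) (x p : 'rV[R]_n) : \bar R :=
  ereal_sup [set (dot p (f t x a) - l t x a)%:E | a in A].

Definition Lagrangian (R : realType) (n : nat)
    (H : R -> 'rV[R]_n -> 'rV[R]_n -> \bar R)
    (t : R) (x v : 'rV[R]_n) : \bar R :=
  ereal_sup [set ((dot v p)%:E - H t x p)%E | p in [set: 'rV[R]_n]].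

Definition dom (R : realType) (X : Type) (phi : X -> \bar R) : set X :=
  [set x | phi x \is a fin_num].

(* Main.v *)
Require Import Defs.
From HB Require Import structures.
From mathcomp Require Import all_boot all_order all_algebra.
From mathcomp Require Import all_classical all_reals all_analysis.
From mathcomp Require Import finmap lra measurable_realfun.

Set Implicit Arguments.
Unset Strict Implicit.
Unset Printing Implicit Defensive.

Import Order.TTheory GRing.Theory Num.Theory.
Import numFieldNormedType.Exports.

Local Open Scope classical_set_scope.
Local Open Scope ring_scope.

(** The function [lambda t x := sup (l t x @` A)], the largest running cost at
    [(t, x)], has all the required properties.

    Upper bound for the Lagrangian ([Lagrangian_dom_le]). Suppose that some [p]
    had [<v, p> - H(p) > max l]. Then [<p, v - f(a)> >= e] for every [a] and
    some fixed [e > 0]: [p] strictly separates [v] from the set [f(A)]. Along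
    the ray [s p], [s >= 0], the quantity [<v, s p> - H(s p)] is then at least
    [s e + min l], so [L(v) = +oo] and [v] is not in the domain. This replaces
    the usual description of [dom L] as the convex hull of [f(A)].

    Regularity. Taking suprema is 1-Lipschitz for the uniform distance
    ([dist_sup_image_le]). Hence [lambda] inherits the modulus of [l], on the
    same null sets. It also inherits continuity, in [x] and jointly, because on
    the compact set [A] continuity in [(x, a)] is uniform in [a]
    ([continuous_sup_compact]).

    Measurability in [t] ([measurable_sup_compact]). Since [l t x] is continuous
    on [A], the supremum exceeds [c] exactly when [l t x q > c] for some [q] in
    a countable dense subset of [A], which exists by compactness. *)

Section SupOverCompact.
Context {R : realType}.

Lemma dist_sup_image_le {Y : Type} (A : set Y) (g h : Y -> R) (c : R) :
  A !=set0 -> has_ubound (g @` A) -> has_ubound (h @` A) ->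
  (forall a, A a -> `|g a - h a| <= c) ->
  `|sup (g @` A) - sup (h @` A)| <= c.
Proof.
move=> [a0 Aa0].
wlog suff: g h / has_ubound (g @` A) -> has_ubound (h @` A) ->
    (forall a, A a -> `|g a - h a| <= c) -> sup (g @` A) - sup (h @` A) <= c.
  move=> side ubg ubh gh; rewrite ler_norml lerNl opprB !side// => a Aa.
  by rewrite distrC gh.
move=> _ ubh gh; rewrite lerBlDr; apply: ge_sup => [|_ [a Aa <-]].
  by exists (g a0), a0.
rewrite -lerBlDl (le_trans _ (ub_le_sup ubh (imageP h Aa)))//.
by rewrite lerBlDl -lerBlDr (le_trans (ler_norm _))// gh.
Qed.

Lemma within_setX_section {X Y Z : topologicalType} (S : set X) (A : set Y)
    (g : X * Y -> Z) (x : X) :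
  {within S `*` A, continuous g} -> S x ->
  {within A, continuous (fun a => g (x, a))}.
Proof.
move=> /subspace_continuousP cg Sx; apply/subspace_continuousP => a Aa W.
move=> /(cg (x, a) (conj Sx Aa)) [[U V] /= [Ux Va] UVW].
rewrite nbhs_simpl /=; apply: filterS Va => b Vb Ab.
exact: (UVW (x, b) (conj (nbhs_singleton Ux) Vb) (conj Sx Ab)).
Qed.

Lemma compact_image_ubound {Y : topologicalType} (A : set Y) (g : Y -> R) :
  A !=set0 -> compact A -> {within A, continuous g} -> has_ubound (g @` A).
Proof.
move=> A0 cA cg; have [c _ gc] := compact_EVT_max A0 cA cg.
by exists (g c) => _ [a Aa <-]; exact/gc/mem_set.
Qed.

(** A supremum of continuous functions is in general only lower semicontinuous.
    Here compactness makes the oscillation of [g] in its first variable small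
    uniformly over [A], and the Lipschitz bound on suprema does the rest. The set [S] is arbitrary, so
    that the lemma covers both continuity in [x] at a fixed time and joint
    continuity on [[0, T] x R^n]. *)
Lemma continuous_sup_compact {X Y : topologicalType} (S : set X) (A : set Y)
    (g : X * Y -> R) : A !=set0 -> compact A ->
  {within S `*` A, continuous g} ->
  {within S, continuous (fun x => sup ((fun a => g (x, a)) @` A))}.
Proof.
move=> A0 cA cg; apply/subspace_continuousP => x Sx.
have ub z : S z -> has_ubound ((fun a => g (z, a)) @` A).
  by move=> Sz; exact/compact_image_ubound/within_setX_section/Sz.
apply/cvgrPdist_le => e e0.
have : \forall z \near within S (nbhs x),
    A `<=` (fun a => `|g (x, a) - g (z, a)| <= e).
  move: cA => /compact_near_coveringP/near_covering_withinP; apply => a Aa.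
  move/subspace_continuousP : cg => /(_ (x, a) (conj Sx Aa)) /cvgrPdist_le.
  move=> /(_ (e / 2)); rewrite divr_gt0// => /(_ isT) [[U V] /= [Ux Va] UVg].
  exists (V, S `&` U) => /=.
    by split=> //; apply: filterS Ux.
  move=> [b z] /= [Vb [Sz Uz]] Ab; rewrite [e]splitr.
  rewrite (le_trans (ler_distD (g (x, a)) _ _))// lerD//.
    by rewrite distrC; apply: (UVg (x, b)); split=> //=; exact: nbhs_singleton.
  exact: (UVg (z, b)).
rewrite !near_withinE; apply: filterS => z gz Sz.
by apply: dist_sup_image_le => //; [exact: ub|exact: ub|exact: gz].
Qed.

(** The centers of finite covers of [A] by balls of radius [1/(k+1)], for all [k],
    form such a set. *)
Lemma compact_countable_dense {Y : normedModType R} (A : set Y) :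
  compact A -> exists D : set Y, [/\ countable D, D `<=` A &
    forall a U, A a -> nbhs a U -> exists2 d, D d & U d].
Proof.
move=> cA.
have net k : exists2 s : {fset Y}, {subset s <= A} &
    A `<=` cover [set` s] (fun d => (ball d (k.+1%:R^-1 : R))°).
  move: cA; rewrite compact_cover; apply => [d _|a Aa].
    exact: open_interior.
  by exists a => //; exact: nbhsx_ballx.
have /choice[s sP] : forall k, exists s : {fset Y}, {subset s <= A} /\
    A `<=` cover [set` s] (fun d => (ball d (k.+1%:R^-1 : R))°).
  by move=> k; have [s ? ?] := net k; exists s.
exists (\bigcup_k [set` s k]); split.
- by apply: bigcup_countable => // k _; exact/finite_set_countable/finite_fset.
- by move=> d [k _] /= /(proj1 (sP k))/set_mem.
- move=> a U Aa /nbhs_ballP[e /= e_gt0 aeU].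
  have [k] := ltr_add_invr e_gt0; rewrite add0r => ke.
  have [d sd /interior_subset da] := proj2 (sP k) a Aa.
  exists d; first by exists k.
  by apply: aeU; apply/ball_sym; exact: le_ball (ltW ke) _ da.
Qed.

(** A strict inequality [g t a > c] persists near [a], so it is already seen on a
    countable dense subset: the superlevel sets of the supremum are countable
    unions of superlevel sets of the [g ^~ q]. *)
Lemma measurable_sup_compact {d} {I : measurableType d}
    {Y : normedModType R} (D : set I) (A : set Y) (g : I -> Y -> R) :
  A !=set0 -> compact A ->
  (forall t, D t -> {within A, continuous (g t)}) ->
  (forall a, A a -> measurable_fun D (g ^~ a)) ->
  measurable_fun D (fun t => sup (g t @` A)).
Proof.
move=> A0 cA cg mg mD; have [Q [countQ QA denseQ]] := compact_countable_dense cA.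
apply: (measurability _ (RGenOInfty.measurableE R)) => //.
move=> _ [_ [c ->] <-]; rewrite preimage_itvoy.
rewrite [X in measurable X](_ : _ =
    \bigcup_(q in Q) (D `&` g ^~ q @^-1` `]c, +oo[%classic)).
  rewrite bigcup_set_type; apply: countable_bigcupT_measurable.
    by rewrite (eq_countable (card_setT _)).
  by move=> q; apply: mg => //; exact/QA/set_valP.
apply/seteqP; split=> t /=.
  move=> [Dt] /(sup_gt (image_nonempty _ A0))[_ [a Aa <-] ca].
  move: (cg t Dt) => /subspace_continuousP/(_ a Aa)/cvgr_gt/(_ _ ca).
  rewrite near_withinE => /(denseQ _ _ Aa)[q Qq /(_ (QA _ Qq)) cq].
  by exists q => //; split=> //=; rewrite in_itv/= andbT.
move=> [q Qq [Dt]] /=; rewrite in_itv/= andbT => cq; split=> //.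
apply: (lt_le_trans cq); apply: ub_le_sup; last by exists q => //; exact: QA.
by apply: compact_image_ubound => //; exact: cg.
Qed.

End SupOverCompact.

(** If [p] violated the bound, the objective defining the Lagrangian would grow
    linearly along the ray through [p], and [v] would lie outside the domain. *)
Lemma Lagrangian_dom_le {R : realType} {n m : nat} (A : set 'rV[R]_m)
    (f : R -> 'rV[R]_n -> 'rV[R]_m -> 'rV[R]_n)
    (l : R -> 'rV[R]_n -> 'rV[R]_m -> R) (t : R) (x v : 'rV[R]_n) (b M : R) :
  A !=set0 -> (forall a, A a -> b <= l t x a <= M) ->
  dom (Lagrangian (Hamiltonian A f l) t x) v ->
  (Lagrangian (Hamiltonian A f l) t x v <= M%:E)%E.
Proof.
move=> [a0 Aa0] lbM; rewrite /dom /=; set L := Lagrangian _ _ _ _ => Lfin.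
apply: ge_ereal_sup => _ [p _ <-]; rewrite leNgt; apply/negP.
set H := Hamiltonian A f l t x.
have ubH a : A a -> ((dot p (f t x a) - l t x a)%:E <= H p)%E.
  by move=> Aa; apply: ereal_sup_ubound; exists a.
case E : (H p) => [h| |] //=; last first.
  by move: (ubH _ Aa0); rewrite E leeNy_eq.
rewrite -EFinB lte_fin => Mh.
(* [e] is the excess of [p] over the bound, and a growth rate along the ray. *)
pose e := dot v p - h - M; have e0 : 0 < e by rewrite /e subr_gt0.
have grow s : 0 <= s -> ((s * e + b)%:E <= L)%E.
  move=> s0.
  apply: (@le_trans _ _ ((dot v (s *: p))%:E - H (s *: p))%E); last first.
    by apply: ereal_sup_ubound; exists (s *: p).
  have : (H (s *: p) <= (dot v (s *: p) - (s * e + b))%:E)%E.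
    apply: ge_ereal_sup => _ [a Aa <-]; rewrite lee_fin.
    have /andP[bl lM] := lbM a Aa.
    have := ubH a Aa; rewrite E lee_fin lerBlDr => pf.
    have -> : dot (s *: p) (f t x a) = s * dot p (f t x a).
      by rewrite /dot big_distrr/=; apply: eq_bigr => i _; rewrite mxE mulrA.
    have -> : dot v (s *: p) = s * dot v p.
      by rewrite /dot big_distrr/=; apply: eq_bigr => i _; rewrite mxE mulrCA.
    have : 0 <= s * (dot v p - e - dot p (f t x a)).
      by rewrite mulr_ge0// /e; lra.
    nra.
  by case: (H (s *: p)) => [h'| |]//=; rewrite ?lee_fin ?leey//; lra.
move: Lfin grow; case: L => // r _ grow.
(* At this point of the ray the lower bound [s e + b] is at least [r + 1]. *)
have s0 : 0 <= (`|r - b| + 1) / e by rewrite divr_ge0 ?(ltW e0) ?addr_ge0.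
have := grow _ s0; rewrite divfK ?gt_eqF// lee_fin.
by have := ler_norm (r - b); lra.
Qed.

Theorem theorem3p3 (R : realType) (n m : nat) (T : R) (hT : 0 <= T)
    (A : set 'rV[R]_m) (A0 : A !=set0) (cA : compact A)
    (f : R -> 'rV[R]_n -> 'rV[R]_m -> 'rV[R]_n)
    (l : R -> 'rV[R]_n -> 'rV[R]_m -> R)
    (f_meas : forall x a, A a ->
      lebesgue_measurable_vfun `[0, T] (fun t => f t x a))
    (l_meas : forall x a, A a ->
      lebesgue_measurable_fun `[0, T] (fun t => l t x a))
    (f_cont : forall t, t \in `[0, T] ->
      {within [set: 'rV[R]_n] `*` A, continuous (fun z => f t z.1 z.2)})
    (l_cont : forall t, t \in `[0, T] ->
      {within [set: 'rV[R]_n] `*` A, continuous (fun z => l t z.1 z.2)})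
    (w : R -> R -> R -> R)
    (w_modulus : forall r, 0 < r -> modulus T (w r))
    (l_w : forall r, 0 < r -> exists N : set R, null_subset T N /\
      forall t x y a, t \in `[0, T] -> ~ N t ->
        eball r x -> eball r y -> A a ->
        `|l t x a - l t y a| <= w r t (enorm (x - y))) :
  exists lambda : R -> 'rV[R]_n -> R,
    (forall x, lebesgue_measurable_fun `[0, T] (lambda ^~ x)) /\
    (forall t, t \in `[0, T] -> continuous (lambda t)) /\
    (forall t x v, t \in `[0, T] ->
      dom (Lagrangian (Hamiltonian A f l) t x) v ->
      (Lagrangian (Hamiltonian A f l) t x v <= (lambda t x)%:E)%E) /\
    (forall r, 0 < r -> exists N : set R, null_subset T N /\
      forall t x y, t \in `[0, T] -> ~ N t -> eball r x -> eball r y ->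
        `|lambda t x - lambda t y| <= w r t (enorm (x - y))) /\
    ({within `[0, T] `*` [set: 'rV[R]_n] `*` A,
        continuous (fun z => f z.1.1 z.1.2 z.2)} ->
     {within `[0, T] `*` [set: 'rV[R]_n] `*` A,
        continuous (fun z => l z.1.1 z.1.2 z.2)} ->
     {within `[0, T] `*` [set: 'rV[R]_n],
        continuous (fun z => lambda z.1 z.2)}).
Proof.
pose lambda t x := sup (l t x @` A).
have slice t x : t \in `[0, T] -> {within A, continuous (l t x)}.
  by move=> t0T; exact: (within_setX_section (l_cont t t0T) I).
have ub t x : t \in `[0, T] -> has_ubound (l t x @` A).
  by move=> t0T; apply: compact_image_ubound => //; exact: slice.
exists lambda; split; [|split; [|split; [|split]]].
- move=> x.
  apply: (@measurable_sup_compact _ _ (lebesgueType R) _ _ A (l ^~ x)) => //.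
  - by move=> t; exact: slice.
  - by move=> a; exact: l_meas.
- move=> t t0T x; have := continuous_sup_compact A0 cA (l_cont t t0T).
  move=> /subspace_continuousP/(_ x I) cx U /cx; rewrite !nbhs_simpl /=.
  by rewrite /within /=; apply: filterS => y; exact.
- move=> t x v t0T.
  have [c _ lc] := compact_EVT_min A0 cA (slice t x t0T).
  apply: (@Lagrangian_dom_le _ _ _ _ _ _ _ _ _ (l t x c)) => // a Aa.
  rewrite lc ?mem_set//=; apply: ub_le_sup; first exact: ub.
  by exists a.
- move=> r r0; have [N [N0 lN]] := l_w r r0.
  exists N; split=> // t x y t0T Nt xr yr.
  by apply: dist_sup_image_le => //; [exact: ub|exact: ub|move=> a Aa; exact: lN].
- by move=> _ /(continuous_sup_compact A0 cA).
Qed.
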